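(* Let $r>0$ be a real number, let $k\ge 0$ be an integer, and let $X\subset Y$ be an inclusion of finite metric spaces such that $d_H(X^{k}_{dis},Y^{k}_{dis})<r$. Suppose that $(t,[x])$ is a layer point of $\Gamma_k(X)$ such that $r<t<t_+-2r$. Then $$\theta_\ast i_\ast(t,[x])=(t,[x]).$$
   Context: For a finite metric space $(X,d)$, an integer $k\ge 0$ and $s\in[0,\infty]$, the degree Rips complex $L_{s,k}(X)$ is the simplicial complex whose simplices are the non-empty subsets $\tau\subset X$ such that $d(x,x')\le s$ for all $x,x'\in\tau$ and each $x\in\tau$ has at least $k$ distinct neighbours $y\in X$ (with $y\neq x$) such that $d(x,y)\le s$. For $s\le t$ there is an inclusion $\sigma: L_{s,k}(X)\subset L_{t,k}(X)$. For a vertex $x$ of $L_{s,k}(X)$, $[x]$ or $[x]_s$ denotes its path component, regarded both as an element of $\pi_0L_{s,k}(X)$ and as a subset of $X$ (the set of vertices in that component). The poset $\Gamma_k(X)$ has elements the pairs $(s,[x])$ with $s\in[0,\infty]$ and $[x]\in\pi_0L_{s,k}(X)$, with $(s,[x])\le(t,[y])$ if and only if $s\le t$ and $[x]=[y]$ in $\pi_0L_{t,k}(X)$ (equivalently $s\le t$ and $[x]_s\subset[y]_t$). A layer point of $\Gamma_k(X)$ is an element $(t,[x])$ such that either 1) whenever $(s,[y])\le(t,[x])$ with $s<t$, the set $[y]_s$ is a proper subset of $[x]_t$, or 2) there is no relation $(s,[y])\le(t,[x])$ with $s<t$. The layer points form the subposet $\mathrm{L}_k(X)\subset\Gamma_k(X)$.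 Every element of $\Gamma_k(X)$ has a unique largest layer point below it, and $\max:\Gamma_k(X)\to \mathrm{L}_k(X)$ is the poset morphism taking an element to the largest layer point below it. The layer parameters of $X$ are the (finitely many) numbers $t$ such that $(t,[x])$ is a layer point of $\Gamma_k(X)$ for some $[x]$. For a layer parameter $t$ of $X$, $t_+$ is the smallest layer parameter of $X$ with $t<t_+$, with the convention $t_+=\infty$ if $t$ is the largest layer parameter. $X^k_{dis}$ denotes the set of $(k+1)$-tuples of distinct elements of $X$; for $X\subset Y$ the Hausdorff distance $d_H(X^k_{dis},Y^k_{dis})$ is computed in $Y^k_{dis}$ with the metric $d((y_i),(y_i'))=\max_i d(y_i,y'_i)$. Under the assumption $d_H(X^k_{dis},Y^k_{dis})<r$, the (known) degree Rips stability theorem provides maps $\theta:L_{s,k}(Y)\to L_{s+2r,k}(X)$, natural in $s$, such that $\theta\cdot i$ and $i\cdot\theta$ are homotopic to the inclusions $\sigma:L_{s,k}(X)\to L_{s+2r,k}(X)$ and $\sigma:L_{s,k}(Y)\to L_{s+2r,k}(Y)$ respectively, where $i$ is induced by $X\subset Y$. On path components this gives functions $\theta:\pi_0L_{s,k}(Y)\to\pi_0L_{s+2r,k}(X)$, $[y]\mapsto[\theta(y)]$, natural in $s$, with $\theta\cdot i=\sigma$ and $i\cdot\theta=\sigma$ on path components. Such a $\theta$ is fixed. There are induced poset morphisms $i:\Gamma_k(X)\to\Gamma_k(Y)$, $(s,[x])\mapsto(s,[i(x)])$, and $\theta:\Gamma_k(Y)\to\Gamma_k(X)$, $(s,[y])\mapsto(s+2r,[\theta(y)])$.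 $i_\ast:\mathrm{L}_k(X)\to\mathrm{L}_k(Y)$ and $\theta_\ast:\mathrm{L}_k(Y)\to\mathrm{L}_k(X)$ are the restrictions of $\max\cdot i$ and $\max\cdot\theta$ to layer points: $i_\ast(s,[x])$ is the largest layer point of $\Gamma_k(Y)$ below $(s,[i(x)])$, and $\theta_\ast(s,[y])$ is the largest layer point of $\Gamma_k(X)$ below $(s+2r,[\theta(y)])$. *)

(* Defs.v *)
From HB Require Import structures.
From mathcomp Require Import boolp classical_sets functions filter.
From mathcomp Require Import reals topology.
From mathcomp Require Import interval_inference constructive_ereal.
From mathcomp Require Import metric_structure.
From mathcomp Require Import all_boot all_order all_algebra.
Set Implicit Arguments.
Unset Strict Implicit.
Unset Printing Implicit Defensive.
Import Order.TTheory GRing.Theory Num.Theory.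
Local Open Scope ring_scope.

#[short(type="finMetricType")]
HB.structure Definition FinMetric (R : numDomainType) :=
  {T of Finite T & Metric R T}.

(* A finite simplicial complex is given by its set K of simplices, which are
   nonempty subsets of T.  Two vertices lie in the same path component exactly
   when they are joined by a path of edges, and a component is represented by
   the set of its vertices. *)
Section PathComponents.
Variable T : finType.
Implicit Types (K : {set {set T}}) (x y : T).

Definition vertices K : {set T} := [set x | [set x] \in K].

Definition edge K : rel T := fun x y => [set x; y] \in K.

Definition path_component K x : {set T} := [set y | connect (edge K) x y].

Definition path_components K : {set {set T}} :=
  [set path_component K x | x in vertices K].

Definition pi0 K : Type := {C : {set T} | C \in path_components K}.

Definition pi0_class K x (Kx : x \in vertices K) : pi0 K :=
  exist _ (path_component K x) (imset_f (path_component K) Kx).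

Lemma pi0_rep K (C : pi0 K) :
  exists x, (x \in vertices K) && (path_component K x == sval C).
Proof.
by case: C => C /= /imsetP[x Kx ->]; exists x; rewrite Kx eqxx.
Qed.

Definition rep K (C : pi0 K) : T := xchoose (pi0_rep C).

Lemma rep_vertex K (C : pi0 K) : rep C \in vertices K.
Proof. by case/andP: (xchooseP (pi0_rep C)). Qed.

Lemma rep_component K (C : pi0 K) : path_component K (rep C) = sval C.
Proof. by case/andP: (xchooseP (pi0_rep C)) => _ /eqP. Qed.

Lemma rep_mem K (C : pi0 K) : rep C \in sval C.
Proof.
have : rep C \in path_component K (rep C) by rewrite inE connect0.
by rewrite rep_component.
Qed.

Lemma vertices_sub K K' : K \subset K' -> vertices K \subset vertices K'.
Proof. by move=> /subsetP KK'; apply/subsetP => x; rewrite !inE => /KK'. Qed.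

(* [x]_K |-> [x]_K' for a subcomplex K of K'; independent of the
   representative by pi0_mapE. *)
Definition pi0_map K K' (KK' : K \subset K') (C : pi0 K) : pi0 K' :=
  pi0_class (subsetP (vertices_sub KK') _ (rep_vertex C)).

Lemma edge_sym K : symmetric (edge K).
Proof. by move=> x y; rewrite /edge finset.setUC. Qed.

Lemma path_componentP K x y :
  reflect (path_component K x = path_component K y) (connect (edge K) x y).
Proof.
have sK : connect_sym (edge K) by exact/sym_connect_sym/edge_sym.
apply: (iffP idP) => [xy|/setP/(_ y)]; last by rewrite !inE connect0.
by apply/setP => z; rewrite !inE (same_connect sK xy).
Qed.

Lemma connect_edge_sub K K' x y :
  K \subset K' -> connect (edge K) x y -> connect (edge K') x y.
Proof.
by move=> /subsetP KK'; apply: connect_sub => u v /KK'; exact: connect1.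
Qed.

Lemma pi0_memE K (C : pi0 K) x : x \in sval C -> path_component K x = sval C.
Proof.
by rewrite -(rep_component C) inE => /path_componentP.
Qed.

Lemma pi0_mapE K K' (KK' : K \subset K') (C : pi0 K) x :
  x \in sval C -> sval (pi0_map KK' C) = path_component K' x.
Proof.
rewrite -(rep_component C) inE => /(connect_edge_sub KK')/path_componentP.
by [].
Qed.

Lemma pi0_map_sub K K' (KK' : K \subset K') (C : pi0 K) :
  sval C \subset sval (pi0_map KK' C).
Proof.
apply/subsetP => x Cx; rewrite (pi0_mapE KK' Cx) inE; exact: connect0.
Qed.

Lemma pi0_inj K (C D : pi0 K) : sval C = sval D -> C = D.
Proof. exact: val_inj. Qed.

End PathComponents.

Section DegreeRips.
Variables (R : realType) (T : finMetricType R).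
Implicit Types (A B : {set T}) (k : nat) (s t : {nonneg \bar R}).

Definition neighbours (s : \bar R) A (x : T) : {set T} :=
  [set y in A | (y != x) && ((mdist x y)%:E <= s)%E].

(* L_{s,k}(A) for the finite metric space A, a subspace of T. *)
Definition rips (s : \bar R) k A : {set {set T}} :=
  [set tau : {set T} |
    [&& tau != finset.set0, tau \subset A,
        [forall x in tau, forall y in tau, ((mdist x y)%:E <= s)%E] &
        [forall x in tau, (k <= #|neighbours s A x|)%N]]].

Lemma rips_sub (s t : \bar R) k A B :
  (s <= t)%E -> A \subset B -> rips s k A \subset rips t k B.
Proof.
move=> st AB; apply/subsetP => tau; rewrite !inE.
case/and4P => -> tauA /forall_inP H1 /forall_inP H2 /=.
rewrite (subset_trans tauA AB) /=; apply/andP; split.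
  apply/forall_inP => x xt; apply/forall_inP => y yt.
  by rewrite (le_trans _ st)//; exact: (forall_inP (H1 _ xt)).
apply/forall_inP => x xt; apply: (leq_trans (H2 _ xt)); apply: subset_leq_card.
apply/subsetP => y; rewrite !inE => /andP[yA /andP[-> ds]] /=.
by rewrite (subsetP AB)// (le_trans ds).
Qed.

Definition sigma s t (st : (s%:num <= t%:num)%E) k A :
    pi0 (rips s%:num k A) -> pi0 (rips t%:num k A) :=
  pi0_map (rips_sub k st (subxx A)).

Record gamma k A := Gamma {
  param : {nonneg \bar R};
  component : pi0 (rips param%:num k A) }.

Definition gamma_le k A (p q : gamma k A) : Prop :=
  exists st : ((param p)%:num <= (param q)%:num)%E,
    sigma st (component p) = component q.

Definition strictly_below k A (q p : gamma k A) : Prop :=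
  gamma_le q p /\ ((param q)%:num < (param p)%:num)%E.

Definition is_layer k A (p : gamma k A) : Prop :=
  (forall q, strictly_below q p ->
     sval (component q) \proper sval (component p)) \/
  (forall q, ~ strictly_below q p).

Record layer k A := Layer {
  layer_pt :> gamma k A;
  layer_ptP : is_layer layer_pt }.

Definition is_largest_layer_below k A (p : gamma k A) (l : layer k A) : Prop :=
  gamma_le l p /\ forall l' : layer k A, gamma_le l' p -> gamma_le l' l.

Lemma gamma_leP k A (p q : gamma k A) :
  gamma_le p q <-> ((param p)%:num <= (param q)%:num)%E /\
                   sval (component p) \subset sval (component q).
Proof.
split=> [[st e]|[st pq]]; first by split=> //; rewrite -e pi0_map_sub.
exists st; apply: pi0_inj.
have xp := rep_mem (component p).
by rewrite (pi0_mapE _ xp) (pi0_memE (subsetP pq _ xp)).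
Qed.

Lemma is_layerP k A (p : gamma k A) :
  (forall q, strictly_below q p -> sval (component q) <> sval (component p)) ->
  is_layer p.
Proof.
move=> h; left => q qp; have [/gamma_leP[_ sub] _] := qp.
by rewrite finset.properEneq sub andbT; apply/eqP/h.
Qed.

Lemma rips_dist (s : \bar R) k A (v : T * T) :
  ((mdist v.1 v.2)%:E <= s)%E ->
  (forall u : T * T, ((mdist u.1 u.2)%:E <= s)%E ->
     mdist u.1 u.2 <= mdist v.1 v.2) ->
  rips (mdist v.1 v.2)%:E k A = rips s k A.
Proof.
move=> vs vmax; apply/eqP; rewrite finset.eqEsubset rips_sub//=.
have E (x y : T) :
    ((mdist x y)%:E <= (mdist v.1 v.2)%:E)%E = ((mdist x y)%:E <= s)%E.
  apply/idP/idP => [/le_trans/(_ vs)//|xys].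
  by rewrite lee_fin; exact: (vmax (x, y) xys).
apply/subsetP => tau; rewrite !inE => /and4P[-> ->] /= H1 H2.
apply/andP; split.
  by apply/forall_inP => x /(forall_inP H1)/forall_inP H;
     apply/forall_inP => y /H; rewrite E.
apply/forall_inP => x /(forall_inP H2); congr (_ <= _)%N.
by apply: eq_card => y; rewrite !inE E.
Qed.

Lemma component_dist s k A (C : {set T}) :
  C \in path_components (rips s%:num k A) ->
  exists2 v : T * T, ((mdist v.1 v.2)%:E <= s%:num)%E &
    C \in path_components (rips (mdist v.1 v.2)%:E k A).
Proof.
move=> Cs; have [x _ _] := imsetP Cs.
have x0 : ((mdist (x, x).1 (x, x).2)%:E <= s%:num)%E.
  by rewrite /= mdistxx; exact: ge0e.
have [v vs vmax] := @arg_maxP _ _ _ (x, x)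
  (fun u : T * T => ((mdist u.1 u.2)%:E <= s%:num)%E)
  (fun u => mdist u.1 u.2) x0.
by exists v => //; rewrite (rips_dist _ _ vs).
Qed.

Lemma max_exists k A (p : gamma k A) :
  exists l : layer k A, is_largest_layer_below p l.
Proof.
case: p => t [C Ct].
pose P (u : T * T) := C \in path_components (rips (mdist u.1 u.2)%:E k A).
have [v0 v0t v0C] := component_dist Ct.
have [v vC vmin] := @arg_minP _ _ _ v0 P (fun u => mdist u.1 u.2) v0C.
have vt : ((mdist v.1 v.2)%:E <= t%:num)%E.
  by rewrite (le_trans _ v0t)// lee_fin vmin.
pose s : {nonneg \bar R} := ((NngNum (mdist_ge0 v.1 v.2))%:num%:E%:itv)%E.
pose inK (D : {set T}) := D \in path_components (rips s%:num k A).
pose q : gamma k A := @Gamma k A s (exist inK C vC).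
have smin (u : {nonneg \bar R}) :
    C \in path_components (rips u%:num k A) -> (s%:num <= u%:num)%E.
  move=> /component_dist[w wu wC].
  by rewrite (le_trans _ wu)//= lee_fin vmin.
have ql : is_layer q.
  apply: is_layerP => -[u [B Bu]] [_ /= us] BC; move: Bu; rewrite BC => /smin.
  by rewrite leNgt us.
exists (Layer ql); split=> /=; first by apply/gamma_leP.
move=> [[u [B Bu]] l] /gamma_leP[/= ut BC]; apply/gamma_leP; split => //=.
rewrite leNgt; apply/negP => su.
have qu : (s%:num <= u%:num)%E by exact: ltW.
pose b := @Gamma k A u (exist _ B Bu).
have xB := rep_mem (component b); rewrite /= in xB.
have xC := subsetP BC _ xB.
have qb : gamma_le q b.
  exists qu; apply: pi0_inj.
  apply: etrans (@pi0_mapE _ _ _ _ (component q) _ xC) _.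
  exact: (@pi0_memE _ _ (component b) _ xB).
have CB : C \subset B by have /gamma_leP[] := qb.
by case: l => [/(_ q (conj qb su))|/(_ q)]; [rewrite properE CB BC| case].
Qed.

Definition gamma_max k A (p : gamma k A) : layer k A :=
  sval (cid (max_exists p)).

Definition layer_param k A (t : \bar R) : Prop :=
  exists p : layer k A, t = (param p)%:num.

(* t_+; there are only finitely many layer parameters, so the default value
   +oo is taken only when no layer parameter exceeds t. *)
Definition next_param k A (t : \bar R) : \bar R :=
  xget +oo%E [set u : \bar R |
    [/\ layer_param k A u, (t < u)%E &
        forall v, layer_param k A v -> (t < v)%E -> (u <= v)%E]]%classic.

End DegreeRips.

Section Hausdorff.
Variables (R : realType) (V : finType) (d : V -> V -> R).

Definition dist_to_set (v : V) (B : {set V}) : \bar R :=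
  \big[Order.min/+oo%E]_(b in B) (d v b)%:E.

(* The values of d are expected to be nonnegative; the distance between the
   empty set and a nonempty one is +oo. *)
Definition hausdorff_dist (A B : {set V}) : \bar R :=
  Order.max (\big[Order.max/0%E]_(a in A) dist_to_set a B)
            (\big[Order.max/0%E]_(b in B) dist_to_set b A).

End Hausdorff.

Section DistinctTuples.
Variables (R : realType) (T : finMetricType R) (k : nat).

Definition dis_tuples (A : {set T}) : {set k.+1.-tuple T} :=
  [set u : k.+1.-tuple T | uniq u & all (mem A) u].

Definition tuple_dist (u v : k.+1.-tuple T) : R :=
  \big[Order.max/0]_(i < k.+1) mdist (tnth u i) (tnth v i).

End DistinctTuples.

Section Comparison.
Variables (R : realType) (Y : finMetricType R) (X : {set Y}) (k : nat).
Variable r : {posnum R}.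
Implicit Types s t : {nonneg \bar R}.

Definition shift2r s : {nonneg \bar R} :=
  ItvInstances.adde_inum s ((2 * r%:num)%R%:E%:nng)%E.

Lemma shift2rE s : (shift2r s)%:num = (s%:num + (2 * r%:num)%:E)%E.
Proof. by []. Qed.

Lemma le_shift2r s : (s%:num <= (shift2r s)%:num)%E.
Proof. by rewrite shift2rE leeDl// lee_fin. Qed.

Lemma shift2r_le s t :
  (s%:num <= t%:num)%E -> ((shift2r s)%:num <= (shift2r t)%:num)%E.
Proof. by move=> st; rewrite !shift2rE leeD2r. Qed.

Definition incl s : pi0 (rips s%:num k X) -> pi0 (rips s%:num k [set: Y]) :=
  pi0_map (rips_sub k (lexx s%:num) (finset.subsetT X)).

Definition shift_map :=
  forall s, pi0 (rips s%:num k [set: Y]) -> pi0 (rips (shift2r s)%:num k X).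

(* What degree Rips stability gives on path components: the functions induced
   by the maps theta : L_{s,k}(Y) -> L_{s+2r,k}(X) are natural in s, and the
   homotopies from theta i and i theta to the inclusions become equalities. *)
Definition is_stability_map (theta : shift_map) : Prop :=
  [/\ forall s t (st : (s%:num <= t%:num)%E) c,
        theta t (sigma st c) = sigma (shift2r_le st) (theta s c),
      forall s c, theta s (incl c) = sigma (le_shift2r s) c &
      forall s c, incl (theta s c) = sigma (le_shift2r s) c].

Definition gamma_incl (p : gamma k X) : gamma k [set: Y] :=
  Gamma (incl (component p)).

Definition gamma_theta (theta : shift_map) (p : gamma k [set: Y]) : gamma k X :=
  Gamma (theta (param p) (component p)).

Definition i_star (p : layer k X) : layer k [set: Y] :=
  gamma_max (gamma_incl p).

Definition theta_star (theta : shift_map) (p : layer k [set: Y]) : layer k X :=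
  gamma_max (gamma_theta theta p).

End Comparison.

(* Main.v *)
Require Import Defs.
From mathcomp Require Import boolp classical_sets functions filter.
From mathcomp Require Import reals topology.
From mathcomp Require Import interval_inference constructive_ereal.
From mathcomp Require Import metric_structure.
From mathcomp Require Import all_boot all_order all_algebra.
From mathcomp Require Import lra.
Set Implicit Arguments.
Unset Strict Implicit.
Unset Printing Implicit Defensive.
Import Order.TTheory GRing.Theory Num.Theory.
Local Open Scope ring_scope.

(** Write q = (s, D) for the layer point of Y that the inclusion assigns to
p = (t, [x]).  The claim is that p is the largest layer point below
theta q = (s + 2r, theta D).

Passing to the largest layer point below an element lowers the parameter
without changing the set of vertices ([gamma_max_component]): one goes back to
the first parameter at which that set appears as a component.  In particular D
is still the full component of x in L_t(Y), and so it contains [x]_t.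

Upper bound.  By naturality of theta and theta i = sigma, theta q lies below
(t + 2r, [x]).  The hypothesis on t_+ says that no layer parameter lies in
]t, t + 2r], so p is the largest layer point below (t + 2r, [x])
([gamma_max_gap]).  Hence every layer point below theta q is below p, and,
since the component of x has not changed between t and t + 2r, the set
theta D is contained in [x]_t.

Lower bound.  Once t <= s + 2r is known, p <= theta q follows: theta D is a
component contained in [x]_t, so it is the image of [x]_t.  The point is thus
that q cannot be born too early.  A vertex of L_{s,k}(Y) comes with a
(k+1)-tuple of distinct points; the Hausdorff bound replaces it by a tuple of
distinct points of X at distance less than r.  By this replacement, a path in
L_{s,k}(Y) between two points of X yields a path in L_{s+2r,k}(X) between the
same points.  So all points of X in D, and with them [x]_t, lie in
one component of L_{s+2r,k}(X) ([component_collapse]).  If s + 2r < t, that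
component would be equal to [x]_t, although p is a layer point and therefore
its set of vertices is not a component at any smaller parameter. *)

(** * Layer points and births of components *)

Section LayerPoints.
Variables (R : realType) (T : finMetricType R) (k : nat) (A : {set T}).
Implicit Types (p q : gamma k A) (l m : layer k A).

Lemma gamma_le_refl p : gamma_le p p.
Proof. by apply/gamma_leP. Qed.

Lemma gamma_le_trans q p p' : gamma_le p q -> gamma_le q p' -> gamma_le p p'.
Proof.
move=> /gamma_leP[pq Cpq] /gamma_leP[qp' Cqp']; apply/gamma_leP; split.
  exact: le_trans pq qp'.
exact: subset_trans Cpq Cqp'.
Qed.

Lemma gamma_ext p q :
  (param p)%:num = (param q)%:num ->
  sval (component p) = sval (component q) -> p = q.
Proof.
case: p q => [s C] [t D] /= /val_inj st; case: t / st D => D CD.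
by congr Gamma; exact: pi0_inj.
Qed.

(** Distinct components at one parameter are disjoint, so two comparable
elements with the same parameter are equal. *)
Lemma gamma_le_param_ge p q :
  gamma_le p q -> ((param q)%:num <= (param p)%:num)%E -> gamma_le q p.
Proof.
move=> /gamma_leP[pq Cpq] qp.
suff -> : q = p by exact: gamma_le_refl.
have st : param q = param p by apply: val_inj; apply/eqP; rewrite eq_le qp.
case: p q st Cpq {pq qp} => [s C] [t D] /= st; case: s / st C => C /subsetP CD.
have xC := rep_mem C.
by congr Gamma; apply: pi0_inj; rewrite -(pi0_memE xC) -(pi0_memE (CD _ xC)).
Qed.

Lemma layer_le_anti l m : gamma_le l m -> gamma_le m l -> l = m.
Proof.
move=> /gamma_leP[lm Clm] /gamma_leP[ml Cml].
have E : layer_pt l = layer_pt m.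
  apply: gamma_ext; first by apply/eqP; rewrite eq_le lm ml.
  by apply/eqP; rewrite finset.eqEsubset Clm Cml.
case: l m {lm Clm ml Cml} E => [x xl] [y yl] /= xy.
by case: y / xy yl => yl; congr Layer; exact: Prop_irrelevance.
Qed.

Lemma gamma_max_le p : gamma_le (gamma_max p) p.
Proof. by rewrite /gamma_max; case: cid => l []. Qed.

Lemma gamma_max_largest p l : gamma_le l p -> gamma_le l (gamma_max p).
Proof. by rewrite /gamma_max; case: cid => m [_] /= h; exact: h. Qed.

(** Both clauses in the notion of layer point amount to this: the set of
vertices of a layer point is not a component at any smaller parameter. *)
Lemma layer_component_unborn p q :
  is_layer p -> ((param q)%:num < (param p)%:num)%E ->
  sval (component q) = sval (component p) -> False.
Proof.
move=> pl qp E; have qb : strictly_below q p.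
  by split=> //; apply/gamma_leP; rewrite E subxx (ltW qp).
case: pl => [/(_ q qb)|/(_ q)//].
by rewrite E properxx.
Qed.

(** The complex only changes at values of the distance, of which there are
finitely many; so there is a first parameter at which a given set is a
component, and it is one of these values. *)
Lemma birth_exists p : exists q : gamma k A,
  [/\ sval (component q) = sval (component p),
      (exists v : T * T, (param q)%:num = (mdist v.1 v.2)%:E) &
      forall u : gamma k A, sval (component u) = sval (component p) ->
        ((param q)%:num <= (param u)%:num)%E].
Proof.
case: p => t [C Ct] /=.
pose P (u : T * T) := C \in path_components (rips (mdist u.1 u.2)%:E k A).
have [v0 _ v0C] := component_dist Ct.
have [v vC vmin] := @arg_minP _ _ _ v0 P (fun u => mdist u.1 u.2) v0C.
pose s : {nonneg \bar R} := ((NngNum (mdist_ge0 v.1 v.2))%:num%:E%:itv)%E.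
pose inK (D : {set T}) := D \in path_components (rips s%:num k A).
exists (@Gamma _ _ k A s (exist inK C vC)); split=> //=; first by exists v.
move=> [u [B Bu]] /= BC; move: Bu; rewrite BC => /component_dist[w wu wC].
by rewrite (le_trans _ wu)//= lee_fin vmin.
Qed.

(** The birth of the set of vertices of [p] is a layer point below [p] with
that same set, so the largest one cannot have a smaller set. *)
Lemma gamma_max_component p :
  sval (component (gamma_max p)) = sval (component p).
Proof.
have [q [qC _ qmin]] := birth_exists p.
have ql : is_layer q.
  apply: is_layerP => u [_ uq] uC.
  by have := qmin u (etrans uC qC); rewrite leNgt uq.
have qp : gamma_le (Layer ql) p.
  by apply/gamma_leP; rewrite /= qC; split=> //; exact: qmin.
have /gamma_leP[_ Cq] := gamma_max_largest qp.
have /gamma_leP[_ Cm] := gamma_max_le p.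
by apply/eqP; rewrite finset.eqEsubset Cm -qC.
Qed.

Lemma layer_param_dist (t : \bar R) :
  layer_param k A t -> exists v : T * T, t = (mdist v.1 v.2)%:E.
Proof.
move=> [l ->]; have [q [qC [v qv] qmin]] := birth_exists l.
exists v; rewrite -qv; apply/eqP; rewrite eq_le qmin// andbT leNgt.
by apply/negP => ql; exact: (layer_component_unborn (layer_ptP l) ql qC).
Qed.

(** Layer parameters are distances, hence finite in number, so the smallest
one above [t] exists and [next_param] does not take its default value. *)
Lemma next_param_le (t u : \bar R) :
  layer_param k A u -> (t < u)%E -> (next_param k A t <= u)%E.
Proof.
move=> uA tu.
pose P (v : T * T) :=
  `[< layer_param k A (mdist v.1 v.2)%:E /\ (t < (mdist v.1 v.2)%:E)%E >].
have [v0 v0u] := layer_param_dist uA.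
have v0P : P v0 by apply/asboolP; rewrite -v0u.
have [v /asboolP[vA tv] vmin] :=
  @arg_minP _ _ _ v0 P (fun v => mdist v.1 v.2) v0P.
have wmin w : layer_param k A w -> (t < w)%E -> ((mdist v.1 v.2)%:E <= w)%E.
  move=> wA tw; have [z zw] := layer_param_dist wA; rewrite zw lee_fin.
  by apply: vmin; apply/asboolP; rewrite -zw.
rewrite /next_param; case: xgetP => [w _ [_ _ h]|h]; first exact: h.
by case: (h (mdist v.1 v.2)%:E).
Qed.

(** The largest layer point below [p] has its parameter between those of [l]
and [p], so the gap forces it to be that of [l]. *)
Lemma gamma_max_gap l p :
  gamma_le l p -> ((param p)%:num < next_param k A (param l)%:num)%E ->
  gamma_max p = l.
Proof.
move=> lp gap; apply: layer_le_anti; last exact: gamma_max_largest.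
have lm := gamma_max_largest lp.
have /gamma_leP[mp _] := gamma_max_le p.
have ml : ((param (gamma_max p))%:num <= (param l)%:num)%E.
  rewrite leNgt; apply/negP => /next_param_le h.
  have : (next_param k A (param l)%:num <= (param (gamma_max p))%:num)%E.
    by apply: h; exists (gamma_max p).
  by rewrite leNgt (le_lt_trans mp gap).
exact: gamma_le_param_ge.
Qed.

End LayerPoints.

(** * Vertices and edges of degree Rips complexes *)

Section RipsEdges.
Variables (R : realType) (T : finMetricType R) (k : nat).
Implicit Types (A : {set T}) (s : \bar R) (x y : T).

Lemma rips_vertexE s A x : (0 <= s)%E ->
  (x \in vertices (rips s k A)) = (x \in A) && (k <= #|neighbours s A x|)%N.
Proof.
move=> s0; rewrite !inE finset.sub1set -finset.card_gt0 cards1 /=.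
congr andb; apply/andP/idP => [[_ /forall_inP/(_ x)]|h].
  by rewrite inE eqxx; exact.
split; last by apply/forall_inP => y /finset.set1P ->.
apply/forall_inP => y /finset.set1P ->.
by apply/forall_inP => z /finset.set1P ->; rewrite mdistxx.
Qed.

Lemma rips_edgeE s A x y : (0 <= s)%E ->
  edge (rips s k A) x y =
  [&& x \in vertices (rips s k A), y \in vertices (rips s k A) &
      ((mdist x y)%:E <= s)%E].
Proof.
move=> s0; rewrite !rips_vertexE// /edge inE.
apply/and4P/and3P => [[_ /subsetP xyA /forall_inP ds /forall_inP nb]|].
  have xE : x \in [set x; y] by rewrite !inE eqxx.
  have yE : y \in [set x; y] by rewrite !inE eqxx orbT.
  by rewrite !xyA// !nb//; split=> //; exact: (forall_inP (ds x xE)).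
move=> [/andP[xA nx] /andP[yA ny] ds]; split.
- by apply/finset.set0Pn; exists x; rewrite !inE eqxx.
- by apply/subsetP => z /finset.set2P[] ->.
- apply/forall_inP => u /finset.set2P[] ->; apply/forall_inP => v
    /finset.set2P[] ->; rewrite ?mdistxx//.
  by rewrite metric_sym.
- by apply/forall_inP => z /finset.set2P[] ->.
Qed.

Lemma rips_component_vertex s A (C : pi0 (rips s k A)) x : (0 <= s)%E ->
  x \in sval C -> x \in vertices (rips s k A).
Proof.
move=> s0 xC; have repx : connect (edge (rips s k A)) x (rep C).
  by apply/path_componentP; rewrite (pi0_memE xC) rep_component.
case/connectP: repx => -[_ /= <-|y w /=]; first exact: rep_vertex.
by rewrite {1}rips_edgeE// => /andP[/and3P[]].
Qed.

(** At most one entry of [u] is [x], and the [k] others are neighbours. *)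
Lemma rips_vertex_tuple s A x (u : k.+1.-tuple T) :
  (0 <= s)%E -> x \in A -> u \in dis_tuples k A ->
  (forall i, ((mdist x (tnth u i))%:E <= s)%E) ->
  x \in vertices (rips s k A).
Proof.
move=> s0 xA; rewrite inE => /andP[uu /allP uA] near.
rewrite rips_vertexE// xA /=.
have sub : [set y in u] :\ x \subset neighbours s A x.
  apply/subsetP => y; rewrite !inE => /andP[-> yu].
  have -> /= : y \in A by exact: uA.
  by have /tnthP[i ->] := yu.
apply: leq_trans (subset_leq_card sub).
have := cardsD1 x [set y in u]; rewrite cardsE (card_uniqP uu) size_tuple.
by move=> E; rewrite -ltnS [leqLHS]E -[leqRHS]add1n leq_add2r leq_b1.
Qed.

Lemma rips_vertex_witness s A x : (0 <= s)%E -> x \in vertices (rips s k A) ->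
  exists2 u : k.+1.-tuple T, u \in dis_tuples k A &
    tnth u ord0 = x /\ forall i, ((mdist x (tnth u i))%:E <= s)%E.
Proof.
move=> s0; rewrite rips_vertexE// => /andP[xA nb].
pose N := take k (enum (neighbours s A x)).
have NE y : y \in N -> y \in neighbours s A x.
  by move=> /mem_take; rewrite mem_enum.
have sN : size (x :: N) == k.+1 by rewrite /= size_takel// -cardE.
exists (Tuple sN).
  rewrite inE /= take_uniq ?enum_uniq// andbT xA /=; apply/andP; split.
    by apply/negP => /NE; rewrite !inE eqxx andbF.
  by apply/allP => y /NE; rewrite !inE => /andP[].
split=> // i; have := mem_tnth i (Tuple sN); rewrite inE => /orP[/eqP ->|/NE].
  by rewrite mdistxx.
by rewrite !inE => /and3P[].
Qed.

Lemma hausdorff_tuple_near (A B : {set T}) (e : R) (u : k.+1.-tuple T) :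
  (hausdorff_dist (@tuple_dist R T k) (dis_tuples k A) (dis_tuples k B)
     < e%:E)%E ->
  u \in dis_tuples k B ->
  exists2 v, v \in dis_tuples k A & forall i, mdist (tnth u i) (tnth v i) < e.
Proof.
rewrite /hausdorff_dist gt_max => /andP[_ /bigmax_ltP[_ h]] /h.
rewrite /dist_to_set => /bigmin_ltP[//|[v vA]]; rewrite lte_fin => uv.
exists v => // i; apply: le_lt_trans uv.
exact: (le_bigmax 0 (fun i => mdist (tnth u i) (tnth v i)) i).
Qed.

End RipsEdges.

(** * Replacing paths in Y by paths in X *)

Section Approximation.
Variables (R : realType) (Y : finMetricType R) (X : {set Y}) (k : nat).
Variable r : {posnum R}.
Hypothesis XY : (hausdorff_dist (@tuple_dist R Y k)
  (dis_tuples k X) (dis_tuples k [set: Y]) < r%:num%:E)%E.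
Variable s : {nonneg \bar R}.

Let KX := rips (shift2r r s)%:num k X.
Let KY := rips s%:num k [set: Y].

Let s0 : (0 <= s%:num)%E. Proof. exact: ge0e. Qed.
Let s2r0 : (0 <= (shift2r r s)%:num)%E. Proof. exact: ge0e. Qed.

(** A tuple witnessing that [y] is a vertex, moved into [X], witnesses that
[x] is one: the shift of [2r] pays for one [r] from [x] to [y] and one for
moving the tuple.  The case [x = y] shows that a point of [X] that is a vertex
over [Y] for [s] is a vertex over [X] for [s + 2r]. *)
Lemma near_vertex x y : y \in vertices KY -> x \in X -> mdist x y <= r%:num ->
  x \in vertices KX.
Proof.
move=> /(rips_vertex_witness s0)[u uY [_ us]] xX xy.
have [v vX uv] := hausdorff_tuple_near XY uY.
apply: (rips_vertex_tuple s2r0 xX vX) => i.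
rewrite shift2rE.
have -> : 2 * r%:num = r%:num + r%:num by lra.
have h1 := metric_triangle x y (tnth v i).
have h2 := metric_triangle y (tnth u i) (tnth v i).
apply: (@le_trans _ _ ((mdist y (tnth u i))%:E + (r%:num + r%:num)%:E)%E).
  by rewrite -EFinD lee_fin; have := uv i; lra.
by rewrite leeD2r.
Qed.

Lemma near_vertex_exists y : y \in vertices KY ->
  exists2 x, x \in X & mdist x y <= r%:num.
Proof.
move=> /(rips_vertex_witness s0)[u uY [uy _]].
have [v vX uv] := hausdorff_tuple_near XY uY.
exists (tnth v ord0); last by rewrite metric_sym -uy ltW.
by move: vX; rewrite inE => /andP[_ /allP]; apply; exact: mem_tnth.
Qed.

Lemma near_edge x x' y y' : x \in X -> x' \in X ->
  y \in vertices KY -> y' \in vertices KY -> ((mdist y y')%:E <= s%:num)%E ->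
  mdist x y <= r%:num -> mdist x' y' <= r%:num -> edge KX x x'.
Proof.
move=> xX x'X yY y'Y yy' xy x'y'.
rewrite rips_edgeE// (near_vertex yY)// (near_vertex y'Y)//= shift2rE.
have h1 := metric_triangle x y x'.
have h2 := metric_triangle y y' x'.
apply: (@le_trans _ _ ((mdist y y')%:E + (2 * r%:num)%:E)%E).
  by rewrite -EFinD lee_fin; move: x'y'; rewrite metric_sym; lra.
by rewrite leeD2r.
Qed.

(** Each intermediate vertex of a path is replaced by a nearby point of [X];
consecutive replacements are within [s + 2r]. *)
Lemma near_connect x x' y y' : x \in X -> x' \in X -> y \in vertices KY ->
  mdist x y <= r%:num -> mdist x' y' <= r%:num ->
  connect (edge KY) y y' -> connect (edge KX) x x'.
Proof.
move=> xX x'X yY xy x'y' /connectP[w]; elim: w x xX y yY xy => [|z w IH] x xX y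
  yY xy /=.
  move=> _ E; apply: connect1; apply: (near_edge xX x'X yY yY) => //.
    by rewrite mdistxx.
  by rewrite -E.
rewrite {1}rips_edgeE// => /andP[/and3P[_ zY yz] wz] E.
have [x1 x1X x1z] := near_vertex_exists zY.
apply: (@connect_trans _ _ x1).
  exact: connect1 (near_edge xX x1X yY zY yz xy x1z).
exact: IH x1X _ zY x1z wz E.
Qed.

(** The vertices of [D] in [X] stay where they are when a path in [D] is
replaced by one in [X], so they all end up in a single component. *)
Lemma component_collapse (D : pi0 KY) x : x \in X -> x \in sval D ->
  exists2 G : pi0 KX, x \in sval G & sval D :&: X \subset sval G.
Proof.
move=> xX xD.
have near (z : Y) : mdist z z <= r%:num by rewrite mdistxx.
have vD z : z \in sval D -> z \in vertices KY by exact: rips_component_vertex.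
have xK := near_vertex (vD _ xD) xX (near x).
exists (pi0_class xK); first by rewrite inE connect0.
apply/subsetP => z /finset.setIP[zD zX]; rewrite inE.
apply: (near_connect xX zX (vD _ xD) (near x) (near z)).
by apply/path_componentP; rewrite (pi0_memE xD) (pi0_memE zD).
Qed.

End Approximation.

(** * Comparison of layer points *)

Theorem corollary15 (R : realType) (r : {posnum R}) (k : nat)
  (Y : finMetricType R) (X : {set Y})
  (hXY : (hausdorff_dist (@tuple_dist R Y k)
            (dis_tuples k X) (dis_tuples k [set: Y]) < r%:num%:E)%E)
  (theta : shift_map X k r) (htheta : is_stability_map theta)
  (p : layer k X)
  (hrp : (r%:num%:E < (param p)%:num)%E)
  (hp : ((param p)%:num <
           next_param k X (param p)%:num - (2 * r%:num)%:E)%E) :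
  theta_star theta (i_star p) = p.
Proof.
have [natural theta_incl _] := htheta.
set q := layer_pt (i_star p).
have qp : gamma_le q (gamma_incl p) by exact: gamma_max_le.
pose p2r := Gamma (sigma (le_shift2r r (param p)) (component p)).
have p_le : gamma_le p p2r by exists (le_shift2r r (param p)).
have max_p2r : gamma_max p2r = p.
  by apply: gamma_max_gap p_le _; rewrite shift2rE -lteBrDr.
have thq_le : gamma_le (gamma_theta theta q) p2r.
  have [st e] := qp; exists (shift2r_le r st).
  by rewrite /= -natural e theta_incl.
have sub_thq :
    sval (component (gamma_theta theta q)) \subset sval (component p).
  have /gamma_leP[_] := thq_le.
  by rewrite -(gamma_max_component p2r) max_p2r.
have sub_q : sval (component p) \subset sval (component q).
  have -> : sval (component q) = sval (component (gamma_incl p)).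
    exact: gamma_max_component.
  exact: pi0_map_sub.
(* Otherwise [x]_t would already be a component at s + 2r < t. *)
have born : ((param p)%:num <= (shift2r r (param q))%:num)%E.
  rewrite leNgt; apply/negP => lt_t.
  have xp := rep_mem (component p).
  have pX z : z \in sval (component p) -> z \in X.
    move=> /rips_component_vertex; rewrite rips_vertexE; last exact: ge0e.
    by move=> /(_ (ge0e _))/andP[].
  have [G xG DG] := component_collapse hXY (pX _ xp) (subsetP sub_q _ xp).
  have pG : sval (component p) \subset sval G.
    apply: subset_trans DG; apply/subsetP => z zp.
    by rewrite inE (subsetP sub_q _ zp) pX.
  pose g := @Gamma _ _ k X (shift2r r (param q)) G.
  have Gp : gamma_le g p.
    exists (ltW lt_t); apply: pi0_inj.
    by rewrite (pi0_mapE _ xG) (pi0_memE xp).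
  have /gamma_leP[_ Gsub] := Gp.
  apply: (@layer_component_unborn _ _ _ _ p g (layer_ptP p) lt_t).
  by apply/eqP; rewrite finset.eqEsubset Gsub.
(* The component of theta q is nonempty and contained in that of p, so any of
   its vertices represents both of them at s + 2r. *)
have p_le_thq : gamma_le p (gamma_theta theta q).
  exists born; apply: pi0_inj.
  have eE := rep_mem (component (gamma_theta theta q)).
  by rewrite (pi0_mapE _ (subsetP sub_thq _ eE)) (pi0_memE eE).
apply: layer_le_anti; last exact: gamma_max_largest p_le_thq.
have := @gamma_max_largest _ _ _ _ p2r (theta_star theta (i_star p)).
rewrite max_p2r; apply.
exact: gamma_le_trans (gamma_max_le _) thq_le.
Qed.
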